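(* Let $L\ge N\ge 1$ be integers, let $\mathcal{P}$ be any nearest neighbor path in $\mathbb{Z}^d$ connecting $0$ and $\partial B_1(0,N)$, and let $\{X_n\}_{n\ge 0}$ be a $d$-dimensional simple random walk starting at $0$. Then $$P\big(\mathrm{Trace}(\mathcal{P})\subseteq \mathrm{Trace}(X_0,\dots,X_L)\big)\ \le\ P\big(\mathrm{Trace}(\overset{\nearrow}{\mathcal{P}})\subseteq \mathrm{Trace}(X_0,\dots,X_L)\big),$$ where $$\overset{\nearrow}{\mathcal{P}}=\Big(\mathrm{arc}_1[0:d-1],\ \mathrm{arc}_2[0:d-1],\ \dots,\ \mathrm{arc}_{[N/d]}[0:d-1],\ \mathrm{arc}_{[N/d]+1}[0:N-d[N/d]]\Big),$$ with $$\mathrm{arc}_1[0:d-1]=\Big(0,\ e_1,\ e_1+e_2,\ \dots,\ \sum_{i=1}^{d-1}e_i\Big)$$ and $\mathrm{arc}_k=(k-1)\sum_{i=1}^d e_i+\mathrm{arc}_1$ for $k\ge 1$.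
   Context: $e_1,\dots,e_d$ is the standard basis of $\mathbb{Z}^d$, $[\cdot]$ is the integer part (floor), and $\partial B_1(0,N)=\{x\in\mathbb{Z}^d:\|x\|_1=N\}$. For a finite sequence indexed $0,\dots,d-1$, the notation $[0:m]$ denotes its entries with indices $0,\dots,m$; thus $\overset{\nearrow}{\mathcal{P}}$ is the monotone nearest neighbor path with $N+1$ points starting at $0$ whose successive steps are $e_1,e_2,\dots,e_d,e_1,e_2,\dots$ cyclically. A nearest neighbor path $\mathcal{P}=(P_0,P_1,\dots,P_K)$ (consecutive points at $L_1$-distance $1$) is said to connect $0$ and $\partial B_1(0,N)$ if $P_0=0$ and $\inf\{n:\|P_n\|_1=N\}=K$. $\mathrm{Trace}$ of a sequence of points is the set of points appearing in it. $d$-dimensional simple random walk moves at each step to one of the $2d$ nearest neighbors with equal probability, independently. *)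

(* Defs.v *)
From HB Require Import structures.
From mathcomp Require Import all_boot all_order all_algebra.
From mathcomp Require Import all_classical all_reals all_analysis.

Set Implicit Arguments.
Unset Strict Implicit.
Unset Printing Implicit Defensive.

Import Order.TTheory GRing.Theory Num.Theory.

Local Open Scope classical_set_scope.
Local Open Scope ring_scope.

(* Z^d with the discrete sigma-algebra; an alias of 'rV[int]_d, so that the
   measurable structure is not attached to all matrices. *)
Definition lattice (d : nat) : Type := 'rV[int]_d.

HB.instance Definition _ (d : nat) := GRing.Zmodule.on (lattice d).
HB.instance Definition _ (d : nat) := isPointed.Build (lattice d) 0.
HB.instance Definition _ (d : nat) :=
  @isMeasurable.Build default_measure_display (lattice d)
    discrete_measurable discrete_measurable0
    discrete_measurableC discrete_measurableU.

(* 0-based: basis_vec i is the vector usually written e_(i+1). *)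
Definition basis_vec (d : nat) (i : 'I_d) : lattice d := delta_mx 0 i.

Definition l1norm (d : nat) (x : lattice d) : nat :=
  (\sum_(i < d) `|(x : 'rV[int]_d) 0%R i|)%N.

Definition neighbor (d : nat) : rel (lattice d) :=
  fun x y => l1norm (y - x) == 1%N.

Definition nn_path (d : nat) (p : seq (lattice d)) : bool :=
  sorted (@neighbor d) p.

(* p = (p_0, ..., p_K); find returns the first index at which the norm is N,
   and size p = K + 1 when there is none. *)
Definition connects (d N : nat) (p : seq (lattice d)) : Prop :=
  exists K : nat, [/\ size p = K.+1, p`_0 = 0
                    & find (fun x => l1norm x == N) p = K].

Definition Trace (d : nat) (p : seq (lattice d)) : set (lattice d) := [set` p].

(* arc1 d = (0, e_1, e_1 + e_2, ..., e_1 + ... + e_(d-1)) *)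
Definition arc1 (d : nat) : seq (lattice d) :=
  mkseq (fun m => \sum_(i < d | (i < m)%N) basis_vec i) d.

Definition diag_arc (d k : nat) : seq (lattice d) :=
  [seq (\sum_(i < d) basis_vec i) *+ (k - 1) + x | x <- arc1 d].

(* An index range [0:m] contains m + 1 entries. *)
Definition cyclic_path (d N : nat) : seq (lattice d) :=
  flatten [seq diag_arc d k | k <- iota 1 (N %/ d)] ++
  take (N - d * (N %/ d)).+1 (diag_arc d (N %/ d).+1).

Definition mutually_independent (disp disp' : measure_display)
    (Om : measurableType disp) (V : measurableType disp') (R : realType)
    (Pr : probability Om R) (I : eqType) (Y : I -> Om -> V) : Prop :=
  forall (J : seq I) (A : I -> set V),
    uniq J -> (forall i, measurable (A i)) ->
    Pr (\bigcap_(i in [set` J]) (Y i @^-1` A i)) =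
    (\prod_(i <- J) Pr (Y i @^-1` A i))%E.

Definition increment (d : nat) (Om : Type) (X : nat -> Om -> lattice d)
    (n : nat) : Om -> lattice d :=
  fun w => X n.+1 w - X n w.

Record simple_random_walk (d : nat) (disp : measure_display)
    (Om : measurableType disp) (R : realType) (Pr : probability Om R)
    (X : nat -> {RV Pr >-> lattice d}) : Prop := SimpleRandomWalk {
  srw_start : Pr [set w | X 0%N w = 0] = 1%E;
  srw_uniform : forall (n : nat) (v : lattice d), l1norm v = 1%N ->
    Pr [set w | increment X n w = v] = (((2 * d)%:R : R)^-1)%:E;
  srw_indep : mutually_independent Pr (increment X)
}.

(* Main.v *)
Require Import Defs.
From mathcomp Require Import all_boot all_order all_algebra.
From mathcomp Require Import all_classical all_reals all_analysis.
From mathcomp Require Import perm ring lra zify.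

(** The law of the first L steps is uniform on the (2d)^L nearest neighbor
    walks from 0, so the claim compares the numbers of walks that cover two
    finite sets ([probability_covers]).

    The main tool is a folding inequality ([cover_count_fold]), valid for every
    finite set S.  Let sigma be a reflection of Z^d across a hyperplane that no
    nearest neighbor walk can cross without visiting it, and let the fold map
    keep the points on the side of 0 and reflect the others.  Then at least as
    many walks cover fold(S) as cover S.  Indeed, cut a walk at its visits to
    the hyperplane.  Reflecting any of the excursions permutes the set of walks,
    so the excursions may be given independent uniform signs, the first one
    staying on the side of 0 if 0 is off the hyperplane.  Given the folded walk,
    covering the part of S on the side of 0 is a decreasing event A of the
    signs (a sign being true when its excursion is reflected), covering the
    rest of S is an increasing event B, and covering the reflected rest is a
    decreasing event B' at least as likely as B.  Harris' inequality, used
    twice, gives P(A, B) <= P(A) P(B) <= P(A) P(B') <= P(A, B').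

    It remains to fold the given path onto the cyclic one.  A path from 0 to
    norm N visits every norm 0, ..., N.  Folding across the hyperplanes x_i = 0
    replaces each point by the vector of absolute values of its coordinates, so
    the points now have every coordinate sum 0, ..., N.  The reflections across
    x_i = x_j + c, with c = 1 if i < j and c = 0 if i > j, preserve the
    coordinate sum.  They cut out the alcove
    x_1 >= x_2 >= ... >= x_d >= x_1 - 1, and every fold that moves a point
    brings it closer to the interior point with coordinates - i / d, so that
    finitely many folds move all points into the alcove ([energy_swap]).  The
    alcove contains one point of each coordinate sum ([alcove_coord_sum_inj]),
    and the cyclic path runs through those of sum 0, ..., N: the folded set
    contains its trace ([cover_count_alcove]). *)

Set Implicit Arguments.
Unset Strict Implicit.
Unset Printing Implicit Defensive.
Import Order.TTheory GRing.Theory Num.Theory.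

Local Open Scope classical_set_scope.
Local Open Scope ring_scope.

(** * Harris' inequality for independent uniform signs *)

Fixpoint sign_seqs (m : nat) : seq bitseq :=
  if m is m'.+1 then
    [seq true :: e | e <- sign_seqs m'] ++ [seq false :: e | e <- sign_seqs m']
  else [:: [::]].

Lemma big_sign_seqsS (V : zmodType) m (F : bitseq -> V) :
  \sum_(e <- sign_seqs m.+1) F e =
  \sum_(e <- sign_seqs m) F (true :: e) + \sum_(e <- sign_seqs m) F (false :: e).
Proof. by rewrite /= big_cat /= !big_map. Qed.

Lemma size_sign_seqs m e : e \in sign_seqs m -> size e = m.
Proof.
elim: m e => [|m IH] e /=; first by rewrite inE => /eqP->.
by rewrite mem_cat => /orP[] /mapP[e' /IH <- ->].
Qed.

Arguments sign_seqs : simpl never.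

Lemma big_sign_seqs_negb (V : zmodType) m (F : bitseq -> V) :
  \sum_(e <- sign_seqs m) F (map negb e) = \sum_(e <- sign_seqs m) F e.
Proof.
elim: m F => [|m IH] F; first by rewrite !big_seq1.
rewrite !big_sign_seqsS addrC /=.
by rewrite -(IH (fun e => F (true :: e))) -(IH (fun e => F (false :: e))).
Qed.

Lemma sum_sign_seqs1 m : \sum_(e <- sign_seqs m) 1 = 2 ^+ m :> int.
Proof.
elim: m => [|m IH]; first by rewrite big_seq1 expr0.
by rewrite big_sign_seqsS IH exprS mulr2n mulrDl mul1r.
Qed.

Definition sign_le (e e' : bitseq) := all2 implb e e'.

Lemma sign_le_refl e : sign_le e e.
Proof. by elim: e => //= b e IH; rewrite /sign_le /= implybb. Qed.

(** Induction on the number of signs: for the averages over the two values of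
    the first sign this is Chebyshev's inequality
    (f0 + f1) (g0 + g1) <= 2 (f0 g0 + f1 g1), which holds because f0 - f1 and
    g0 - g1 are both nonnegative. *)
Lemma harris_sign_seqs m (f g : bitseq -> int) :
  (forall e e', sign_le e e' -> f e' <= f e) ->
  (forall e e', sign_le e e' -> g e' <= g e) ->
  (\sum_(e <- sign_seqs m) f e) * (\sum_(e <- sign_seqs m) g e) <=
  2 ^+ m * \sum_(e <- sign_seqs m) f e * g e.
Proof.
elim: m f g => [|m IH] f g fle gle; first by rewrite !big_seq1 mul1r.
have cons_le (F : bitseq -> int) b :
  (forall e e', sign_le e e' -> F e' <= F e) ->
  forall e e', sign_le e e' -> F (b :: e') <= F (b :: e).
  by move=> Fle e e' ee'; apply: Fle; rewrite /sign_le /= implybb.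
have half (F : bitseq -> int) : (forall e e', sign_le e e' -> F e' <= F e) ->
  \sum_(e <- sign_seqs m) F (true :: e) <= \sum_(e <- sign_seqs m) F (false :: e).
  by move=> Fle; apply: ler_sum => e _; apply: Fle; exact: sign_le_refl.
have It := IH _ _ (cons_le f true fle) (cons_le g true gle).
have If := IH _ _ (cons_le f false fle) (cons_le g false gle).
have := half f fle; have := half g gle.
rewrite !big_sign_seqsS exprS; move: It If.
set f1 := \sum_(e <- _) f (true :: e); set f0 := \sum_(e <- _) f (false :: e).
set g1 := \sum_(e <- _) g (true :: e); set g0 := \sum_(e <- _) g (false :: e).
set fg1 := \sum_(e <- _) _ * _; set fg0 := \sum_(e <- _) _ * _.
move=> H1 H0 leg lef.
have : 0 <= (f0 - f1) * (g0 - g1) by rewrite mulr_ge0 // subr_ge0.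
nra.
Qed.

(** * Reflections, excursions and folding *)

Section Fold.
Variable d : nat.
Implicit Types (x y s : lattice d) (w S : seq (lattice d)).

(** The hyperplane is the zero set of the height h.  Since neighbors never have
    heights of opposite strict signs, a walk changes sides only by visiting the
    hyperplane; this excludes, for instance, reflections about half-integers. *)
Record reflection (h : lattice d -> int) (sigma : lattice d -> lattice d) : Prop :=
 Reflection {
  reflK : involutive sigma;
  refl_neighbor : forall x y, neighbor x y -> neighbor (sigma x) (sigma y);
  refl_height : forall x, h (sigma x) = - h x;
  refl_fix : forall x, h x = 0 -> sigma x = x;
  refl_nocross : forall x y, neighbor x y -> 0 < h x -> 0 <= h y;
  refl_origin : 0 <= h 0 }.

Variables (h : lattice d -> int) (sigma : lattice d -> lattice d).
Hypothesis refl : reflection h sigma.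

Definition fold x := if h x < 0 then sigma x else x.

(** The walk w in which an excursion is reflected exactly when its sign is true.
    A sign is attached to every time, and the one in force is that of the last
    visit to the hyperplane; c is the sign in force before the first visit.  One
    sign per time instead of one per excursion makes the sign sequences of all
    walks of a given length the same. *)
Fixpoint flip_excursions (c : bool) (e : bitseq) (w : seq (lattice d)) :=
  if w is x :: w' then
    let c' := if h x == 0 then head false e else c in
    (if c' then sigma x else x) :: flip_excursions c' (behead e) w'
  else [::].

Lemma size_flip c e w : size (flip_excursions c e w) = size w.
Proof. by elim: w c e => //= x w IH c e; rewrite IH. Qed.

Lemma height_if (c : bool) x : (h (if c then sigma x else x) == 0) = (h x == 0).
Proof. by case: c; rewrite // (refl_height refl) oppr_eq0. Qed.

Lemma flipK c e w : flip_excursions c e (flip_excursions c e w) = w.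
Proof.
elim: w c e => //= x w IH c e.
rewrite height_if IH; congr cons.
by case: (if h x == 0 then head false e else c); rewrite ?(reflK refl).
Qed.

Lemma fold_ge0 x : 0 <= h (fold x).
Proof. by rewrite /fold; case: ltP => // ?; rewrite (refl_height refl); lia. Qed.

(** A step stays a step because the sign changes only at a point of the
    hyperplane, which sigma fixes: both ends of the step are moved by the same
    map. *)
Lemma path_flip c e x w : path (@neighbor d) x w ->
  path (@neighbor d) (if c then sigma x else x) (flip_excursions c e w).
Proof.
elim: w c e x => //= y w IH c e x /andP[xy yw].
rewrite IH // andbT.
suff -> : (if if h y == 0 then head false e else c then sigma y else y) =
          (if c then sigma y else y).
  by case: c => //; exact: (refl_neighbor refl).
case: eqP => // /(refl_fix refl) ->; by do 2 case: ifP.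
Qed.

(** Averaging over all signs forgets the signs of the excursions of the original
    walk, so that it may be replaced by its folded version.  Before the first
    visit to the hyperplane no sign is averaged, hence the relation between the
    initial signs c and c'. *)
Lemma sum_flip_fold (F : seq (lattice d) -> int) c c' x w :
  path (@neighbor d) x w ->
  (h x != 0 -> c' = c (+) (h x < 0)) ->
  \sum_(e <- sign_seqs (size w).+1) F (flip_excursions c e (x :: w)) =
  \sum_(e <- sign_seqs (size w).+1) F (flip_excursions c' e (map fold (x :: w))).
Proof.
have fold0 y : (h (fold y) == 0) = (h y == 0) by apply: height_if.
elim: w x c c' F => [|y w IH] x c c' F.
  move=> _ cc'; rewrite !big_sign_seqsS !big_seq1 /= fold0.
  have [x0|x0] := eqVneq (h x) 0.
    by rewrite /fold x0 ltxx.
  rewrite (cc' x0) /fold; case: ltP => _; case: c {cc'} => //=.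
  by rewrite (reflK refl).
move=> /[dup] pw /= /andP[xy yw] cc'.
rewrite [in LHS]big_sign_seqsS [in RHS]big_sign_seqsS /= fold0.
have [x0|x0] := eqVneq (h x) 0.
  have IHe b := IH y b (b (+) (h y < 0)) (fun z => F (x :: z)) yw (fun=> erefl).
  rewrite /= in IHe.
  (* If the next excursion is below the hyperplane, then folding it exchanges
     the two terms of the sum over the sign of x. *)
  have -> : fold x = x by rewrite /fold x0 ltxx.
  rewrite (refl_fix refl x0).
  rewrite 2!IHe; case: (h y < 0) => //=; exact: addrC.
have -> : (if c' then sigma (fold x) else fold x) = (if c then sigma x else x).
  rewrite (cc' x0) /fold; case: ltP => _; case: (c) => //=.
  by rewrite (reflK refl).
have cc'y : h y != 0 -> c' = c (+) (h y < 0).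
  move=> y0; rewrite (cc' x0); congr addb.
  have [hx|hx] := ltP (h x) 0; have [hy|hy] := ltP (h y) 0 => //.
    have := refl_nocross refl (refl_neighbor refl xy).
    by rewrite !(refl_height refl); lia.
  by have := refl_nocross refl xy; lia.
have E := IH y c c' (fun z => F ((if c then sigma x else x) :: z)) yw cc'y.
by rewrite /= in E; rewrite E.
Qed.

(** For a walk above the hyperplane, the reflected excursions are those with sign
    true; fewer of them leave more points visible above. *)
Lemma mem_flip_anti c c' e e' s w :
  0 <= h s -> all (fun x => 0 <= h x) w -> sign_le e e' -> (c ==> c') ->
  s \in flip_excursions c' e' w -> s \in flip_excursions c e w.
Proof.
move=> s0; elim: w c c' e e' => //= x w IH c c' e e' /andP[x0 w0] ee' cc'.
have cc2 : (if h x == 0 then head false e else c) ==>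
           (if h x == 0 then head false e' else c').
  by case: ifP => // _; move: ee'; case: e e' => [|b e] [|b' e'] //= /andP[].
have ee2 : sign_le (behead e) (behead e').
  by move: ee'; case: (e) => [|b e1]; case: (e') => [|b' e1'] //= /andP[].
rewrite !inE => /orP[/eqP sx|sw]; last by rewrite (IH _ _ _ _ w0 ee2 cc2 sw) orbT.
apply/orP; left; apply/eqP; rewrite sx; move: sx cc2.
case: (if _ then head false e' else c'); case: (if _ then head false e else c) => //= sx _.
have : h x = 0 by move: s0; rewrite sx (refl_height refl); lia.
by move/(refl_fix refl).
Qed.

Lemma mem_flip_mono c c' e e' s w :
  h s < 0 -> all (fun x => 0 <= h x) w -> sign_le e e' -> (c ==> c') ->
  s \in flip_excursions c e w -> s \in flip_excursions c' e' w.
Proof.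
move=> s0; elim: w c c' e e' => //= x w IH c c' e e' /andP[x0 w0] ee' cc'.
have cc2 : (if h x == 0 then head false e else c) ==>
           (if h x == 0 then head false e' else c').
  by case: ifP => // _; move: ee'; case: e e' => [|b e] [|b' e'] //= /andP[].
have ee2 : sign_le (behead e) (behead e').
  by move: ee'; case: (e) => [|b e1]; case: (e') => [|b' e1'] //= /andP[].
rewrite !inE => /orP[/eqP sx|sw]; last by rewrite (IH _ _ _ _ w0 ee2 cc2 sw) orbT.
apply/orP; left; apply/eqP; rewrite sx; move: sx cc2.
case: (if _ then head false e else c); case: (if _ then head false e' else c') => //= sx _.
by move: s0; rewrite sx; lia.
Qed.

(** The initial sign is false on the right: an excursion preceding the first
    visit stays above the hyperplane, which can only help to visit sigma s. *)
Lemma mem_flip_negb c e s w :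
  h s < 0 -> all (fun x => 0 <= h x) w -> size e = size w ->
  s \in flip_excursions c e w -> sigma s \in flip_excursions false (map negb e) w.
Proof.
move=> s0 w0 sew sw.
suff : forall c', ~~ (c && c') -> sigma s \in flip_excursions c' (map negb e) w.
  by apply; rewrite andbF.
elim: w c e w0 sew sw => //= x w IH c [|b e] //= /andP[x0 w0] [sew].
move=> sxw c' cc'; move: sxw; rewrite !inE => /orP[/eqP sx|sw]; last first.
  by rewrite (IH _ _ w0 sew sw) ?orbT //; case: ifP => // _; rewrite andbN.
apply/orP; left; apply/eqP; move: s0; rewrite sx.
case: (h x == 0).
  by case: b {sx} => /= s0; [rewrite (reflK refl) | lia].
case: c cc' {sx} => /= [/negPf->|_] s0; [by rewrite (reflK refl) | lia].
Qed.

Definition covers S w := all (fun s => s \in w) S.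

(** Harris' inequality compares two decreasing events directly; for the
    decreasing event a and the increasing event b it is applied to a and
    1 - b, and gives the reverse inequality. *)
Lemma sum_covers_fold S w : all (fun x => 0 <= h x) w ->
  \sum_(e <- sign_seqs (size w)) (covers S (flip_excursions false e w))%:R <=
  \sum_(e <- sign_seqs (size w)) (covers (map fold S) (flip_excursions false e w))%:R :> int.
Proof.
move=> w0; set m := size w.
pose A := [seq s <- S | 0 <= h s]; pose B := [seq s <- S | h s < 0].
pose a e := covers A (flip_excursions false e w).
pose b e := covers B (flip_excursions false e w).
pose b' e := covers (map sigma B) (flip_excursions false e w).
have -> : \sum_(e <- sign_seqs m) (covers S (flip_excursions false e w))%:R =
          \sum_(e <- sign_seqs m) (a e)%:R * (b e)%:R :> int.
  apply: eq_bigr => e _; rewrite -natrM mulnb; congr ((nat_of_bool _)%:R).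
  rewrite /a /b /covers !all_filter -all_predI; apply: eq_all => s /=.
  by case: ltP => /=; rewrite ?andbT.
have -> : \sum_(e <- sign_seqs m) (covers (map fold S) (flip_excursions false e w))%:R =
          \sum_(e <- sign_seqs m) (a e)%:R * (b' e)%:R :> int.
  apply: eq_bigr => e _; rewrite -natrM mulnb; congr ((nat_of_bool _)%:R).
  rewrite /a /b' /covers !all_map !all_filter -all_predI; apply: eq_all => s /=.
  by rewrite /fold; case: ltP => /=; rewrite ?andbT.
have w_size e : e \in sign_seqs m -> size e = size w by apply: size_sign_seqs.
have a_anti e e' : sign_le e e' -> (a e')%:R <= (a e)%:R :> int.
  move=> ee'; case ae' : (a e') => //; suff -> : a e by [].
  apply/allP => s sA; move: (sA); rewrite mem_filter => /andP[s0 _].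
  exact: mem_flip_anti s0 w0 ee' (implybb _) (allP ae' s sA).
have b_mono e e' : sign_le e e' -> (b e)%:R <= (b e')%:R :> int.
  move=> ee'; case be : (b e) => //; suff -> : b e' by [].
  apply/allP => s sB; move: (sB); rewrite mem_filter => /andP[s0 _].
  exact: mem_flip_mono s0 w0 ee' (implybb _) (allP be s sB).
have b'_anti e e' : sign_le e e' -> (b' e')%:R <= (b' e)%:R :> int.
  move=> ee'; case be' : (b' e') => //; suff -> : b' e by [].
  apply/allP => s sB; have /mapP[t] := sB; rewrite mem_filter => /andP[t0 _] st.
  have s0 : 0 <= h s by rewrite st (refl_height refl); lia.
  exact: mem_flip_anti s0 w0 ee' (implybb _) (allP be' s sB).
have le_bb' : \sum_(e <- sign_seqs m) (b e)%:R <=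
              \sum_(e <- sign_seqs m) (b' e)%:R :> int.
  rewrite -(big_sign_seqs_negb _ (fun e => (b' e)%:R)) big_seq [leRHS]big_seq.
  apply: ler_sum => e em; case be : (b e) => //; suff -> : b' (map negb e) by [].
  apply/allP => s /mapP[t tB ->]; move: (tB); rewrite mem_filter => /andP[t0 _].
  exact: mem_flip_negb t0 w0 (w_size e em) (allP be t tB).
have Hb' := harris_sign_seqs m a_anti b'_anti.
have Hb := @harris_sign_seqs m (fun e => (a e)%:R) (fun e => 1 - (b e)%:R) a_anti.
have {Hb} := Hb (fun e e' ee' => lerB (lexx 1) (b_mono e e' ee')).
under [X in _ <= _ * X]eq_bigr do rewrite mulrBr mulr1.
rewrite !sumrB sum_sign_seqs1 => Hb.
have a_ge0 : 0 <= \sum_(e <- sign_seqs m) (a e)%:R :> int.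
  by apply: sumr_ge0.
have M_gt0 : 0 < 2 ^+ m :> int by rewrite exprn_gt0.
rewrite -(ler_pM2l M_gt0); apply: le_trans Hb'.
apply: le_trans (ler_wpM2l a_ge0 le_bb').
by move: Hb; rewrite !mulrBr; lra.
Qed.
End Fold.

(** * Coordinates and unit steps *)

Section Coordinates.
Variable d : nat.
Implicit Types x y : lattice d.

Definition coord x (i : 'I_d) : int := (x : 'rV[int]_d) 0 i.

Lemma coordP x y : (forall i, coord x i = coord y i) -> x = y.
Proof. by move=> xy; apply/rowP. Qed.

Lemma coordD x y i : coord (x + y) i = coord x i + coord y i.
Proof. exact: mxE. Qed.

Lemma coordN x i : coord (- x) i = - coord x i.
Proof. exact: mxE. Qed.

Lemma coordB x y i : coord (x - y) i = coord x i - coord y i.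
Proof. by rewrite coordD coordN. Qed.

Lemma coord0 i : coord 0 i = 0.
Proof. exact: mxE. Qed.

Lemma coord_basis_vec i j : coord (basis_vec i) j = (j == i)%:R.
Proof. by rewrite /coord mxE eqxx. Qed.

Lemma l1normE x : l1norm x = (\sum_(i < d) `|coord x i|)%N.
Proof. by []. Qed.

Lemma l1normN x : l1norm (- x) = l1norm x.
Proof. by rewrite !l1normE; apply: eq_bigr => i _; rewrite coordN abszN. Qed.

Lemma l1norm_basis_vec (i : 'I_d) : l1norm (basis_vec i) = 1%N.
Proof.
rewrite l1normE (bigD1 i) //= coord_basis_vec eqxx big1 // => j /negPf ji.
by rewrite coord_basis_vec ji.
Qed.

Definition unit_steps : seq (lattice d) :=
  [seq basis_vec i | i <- ord_enum d] ++ [seq - basis_vec i | i <- ord_enum d].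

Lemma size_unit_steps : size unit_steps = (2 * d)%N.
Proof. 
have size_ord : size (ord_enum d) = d.
  by rewrite -(size_map val) val_ord_enum size_iota.
by rewrite size_cat !size_map size_ord mul2n addnn.
Qed.

Lemma basis_vec_inj : injective (@basis_vec d).
Proof.
move=> i j /(congr1 (coord^~ i)) /eqP; rewrite !coord_basis_vec eqxx.
by case: (i =P j).
Qed.

Lemma unit_steps_uniq : uniq unit_steps.
Proof.
rewrite cat_uniq !map_inj_uniq ?ord_enum_uniq //=; last exact: basis_vec_inj.
  rewrite andbT; apply/hasPn => _ /mapP[i _ ->]; apply/negP => /mapP[j _].
  move=> /(congr1 (coord^~ i)) /eqP; rewrite coordN !coord_basis_vec eqxx.
  by case: (i == j).
by move=> i j /oppr_inj /basis_vec_inj.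
Qed.

Lemma mem_unit_steps x : (x \in unit_steps) = (l1norm x == 1%N).
Proof.
apply/idP/eqP => [|x1].
  rewrite mem_cat => /orP[] /mapP[i _ ->]; rewrite ?l1normN;
  exact: l1norm_basis_vec.
have [i xi] : exists i, coord x i != 0.
  apply/existsP; apply: contra_eqT x1; rewrite negb_exists => /forallP x0.
  by rewrite l1normE big1 // => i _; have := x0 i; rewrite negbK => /eqP->.
move: x1; rewrite l1normE (bigD1 i) //= => x1.
have xi1 : `|coord x i|%N = 1%N by move: xi x1; lia.
have xj j : j != i -> coord x j = 0.
  move=> ji; apply/eqP; rewrite -absz_eq0; apply: contra_eqT x1 => xj0.
  rewrite (bigD1 j) //=; lia.
have [xi_pos|xi_neg] : coord x i = 1 \/ coord x i = -1 by lia.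
  rewrite mem_cat; apply/orP; left; apply/mapP; exists i; rewrite ?mem_ord_enum //.
  apply: coordP => j; rewrite coord_basis_vec.
  by have [->//|/xj->] := eqVneq j i.
rewrite mem_cat; apply/orP; right; apply/mapP; exists i; rewrite ?mem_ord_enum //.
apply: coordP => j; rewrite coordN coord_basis_vec.
by have [->//|/xj->] := eqVneq j i; rewrite ?oppr0.
Qed.

Lemma neighborE x y : neighbor x y = (y - x \in unit_steps).
Proof. by rewrite mem_unit_steps. Qed.

Lemma neighbor_coord x y i : neighbor x y -> `|coord y i - coord x i| <= 1.
Proof.
move=> /eqP; rewrite l1normE (bigD1 i) //= -coordB; lia.
Qed.

End Coordinates.

(** * The folding inequality for walk counts *)

Section Walks.
Variable d : nat.
Implicit Types (x y : lattice d) (w S T : seq (lattice d)).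

Fixpoint walks_from (n : nat) (x : lattice d) : seq (seq (lattice d)) :=
  if n is n'.+1 then
    [seq x :: w | v <- unit_steps d, w <- walks_from n' (x + v)]
  else [:: [:: x]].

Lemma mem_walks_from n x w :
  reflect (exists2 q, w = x :: q & (size q == n) && path (@neighbor d) x q)
          (w \in walks_from n x).
Proof.
elim: n x w => [|n IH] x w /=.
  rewrite inE; apply: (iffP eqP) => [->|[q -> /andP[/nilP->]]] //.
  by exists [::].
apply: (iffP allpairsPdep) => [[v [w' [vu /IH[q -> /andP[sq pq]] ->]]]|[[|y q] ->]] //=.
  exists (x + v :: q); rewrite //= eqSS sq pq neighborE addrC addKr.
  by rewrite vu.
rewrite eqSS => /and3P[sq xy yq]; exists (y - x), (y :: q).
by rewrite -neighborE xy addrC subrK; split => //; apply/IH; exists q; rewrite ?sq.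
Qed.

Lemma walks_from_uniq n x : uniq (walks_from n x).
Proof.
elim: n x => //= n IH x; apply: allpairs_uniq_dep => //.
  exact: unit_steps_uniq.
move=> _ _ /allpairsPdep[v [w [_ + ->]]] /allpairsPdep[v' [w' [_ + ->]]] /= [].
move=> /mem_walks_from[q -> _] /mem_walks_from[q' -> _] [/addrI -> ->] //.
Qed.

Lemma size_walks_from n x : size (walks_from n x) = ((2 * d) ^ n)%N.
Proof.
elim: n x => //= n IH x; rewrite size_allpairs_dep.
rewrite (eq_map (fun v => IH (x + v))) expnS -size_unit_steps.
move: (size (unit_steps d) ^ n)%N => k.
by elim: (unit_steps d) => //= v s ->; rewrite mulSn.
Qed.

Definition cover_count (n : nat) S : nat :=
  count (covers S) (walks_from n 0).

Lemma cover_countS n S T : {subset T <= S} ->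
  (cover_count n S <= cover_count n T)%N.
Proof.
by move=> TS; apply: sub_count => w /allP Sw; apply/allP => x /TS /Sw.
Qed.

Variables (h : lattice d -> int) (sigma : lattice d -> lattice d).
Hypothesis refl : reflection h sigma.

Lemma perm_flip n e :
  perm_eq (map (flip_excursions h sigma false e) (walks_from n 0)) (walks_from n 0).
Proof.
have flip_stable w : w \in walks_from n 0 ->
    flip_excursions h sigma false e w \in walks_from n 0.
  case/mem_walks_from => q -> /andP[/eqP sq pq]; apply/mem_walks_from => /=.
  set c := if h 0 == 0 then _ else _.
  have c0 : (if c then sigma 0 else 0) = 0.
    by rewrite /c; case: eqP => // /(refl_fix refl) ->; case: ifP.
  exists (flip_excursions h sigma c (behead e) q); first by rewrite c0.
  rewrite size_flip sq eqxx /=.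
  by rewrite -{1}c0; apply: path_flip.
apply: uniq_perm; rewrite ?walks_from_uniq //.
  rewrite map_inj_uniq ?walks_from_uniq //.
  exact: can_inj (flipK refl false e).
move=> w; apply/mapP/idP => [[w' /flip_stable ww ->] //|ww].
by exists (flip_excursions h sigma false e w); rewrite ?flip_stable ?flipK.
Qed.

(** Each sign sequence permutes the walks, so a count of walks is unchanged by
    averaging over sign sequences; then each walk is treated separately. *)
Lemma cover_count_fold n S :
  (cover_count n S <= cover_count n (map (fold h sigma) S))%N.
Proof.
pose W := walks_from n (0 : lattice d); pose M := sign_seqs n.+1.
have sym T : (2 ^+ n.+1 * (cover_count n T)%:R =
    \sum_(w <- W) \sum_(e <- M) (covers T (flip_excursions h sigma false e w))%:R :> int).
  rewrite exchange_big /= -sum_sign_seqs1 mulr_suml; apply: eq_bigr => e _.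
  rewrite mul1r -(big_map _ xpredT (fun w => (covers T w)%:R)).
  rewrite (perm_big _ (perm_flip n e)) /= /cover_count -sum1_count natr_sum.
  by rewrite big_mkcond; apply: eq_bigr => w _; case: covers.
have M0 : 0 < 2 ^+ n.+1 :> int by rewrite exprn_gt0.
rewrite -(ler_nat int) -(ler_pM2l M0) !sym big_seq [leRHS]big_seq.
apply: ler_sum => w /mem_walks_from[q -> /andP[/eqP sq pq]].
have c00 : h 0 != 0 -> false = false (+) (h 0 < 0).
  by rewrite ltNge (refl_origin refl).
have E T := sum_flip_fold refl (fun w => (covers T w)%:R) pq c00.
rewrite sq in E; rewrite /M 2!E; set w' := map _ (0 :: q).
have -> : n.+1 = size w' by rewrite size_map /= sq.
by apply: sum_covers_fold => //; rewrite all_map; apply/allP => x _; exact: fold_ge0.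
Qed.

End Walks.

(** * Folding a path into an alcove *)

Section Reflections.
Variable d : nat.
Implicit Types (x y : lattice d) (i j k : 'I_d) (S T : seq (lattice d)).

Lemma l1norm_triangle x y : (l1norm y <= l1norm x + l1norm (y - x)%R)%N.
Proof.
rewrite !l1normE -big_split /=; apply: leq_sum => i _; rewrite coordB; lia.
Qed.

Lemma neighbor_coord2 x y i j : i != j -> neighbor x y ->
  `|(coord y i - coord x i) - (coord y j - coord x j)| <= 1.
Proof.
move=> ij /eqP; rewrite l1normE (bigD1 i) //= (bigD1 j) 1?eq_sym //= -!coordB.
lia.
Qed.

Definition negate_coord i x : lattice d :=
  \row_k (if k == i then - coord x k else coord x k).

Lemma coord_negate i x k :
  coord (negate_coord i x) k = if k == i then - coord x k else coord x k.
Proof. by rewrite /coord mxE. Qed.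

Lemma reflection_negate i : reflection (fun x => coord x i) (negate_coord i).
Proof.
split=> [x|x y|x|x x0|x y xy|].
- by apply: coordP => k; rewrite !coord_negate; case: eqP => //; rewrite opprK.
- rewrite /neighbor !l1normE => /eqP xy; apply/eqP; rewrite -[RHS]xy.
  by apply: eq_bigr => k _; rewrite !coordB !coord_negate; case: eqP => // _; lia.
- by rewrite coord_negate eqxx.
- by apply: coordP => k; rewrite coord_negate; case: eqP => // ->; rewrite x0 oppr0.
- by have := neighbor_coord i xy; lia.
- by rewrite coord0.
Qed.

(** The reflection across the hyperplane x_i = x_j + c. *)
Definition shifted_swap i j (c : int) x : lattice d :=
  \row_k (coord x (tperm i j k) + c * ((k == i)%:R - (k == j)%:R)).

Lemma coord_swap i j c x k : coord (shifted_swap i j c x) k =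
  coord x (tperm i j k) + c * ((k == i)%:R - (k == j)%:R).
Proof. by rewrite /coord mxE. Qed.

Definition swap_height i j (c : int) x : int := coord x j + c - coord x i.

(** Here c >= 0 puts 0 on the side where heights are nonnegative. *)
Lemma reflection_swap i j c : i != j -> 0 <= c ->
  reflection (swap_height i j c) (shifted_swap i j c).
Proof.
move=> ij c0; have ji : (j == i) = false by rewrite eq_sym; apply: negPf.
split=> [x|x y|x|x x0|x y xy|].
- apply: coordP => k; rewrite !coord_swap tpermK.
  by case: tpermP => [->|->|/eqP/negPf-> /eqP/negPf->]; rewrite ?eqxx ?ji ?(negPf ij); lia.
- rewrite /neighbor !l1normE => /eqP xy; apply/eqP; rewrite -[RHS]xy.
  rewrite [RHS](reindex_inj (@perm_inj _ (tperm i j))) /=.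
  apply: eq_bigr => k _; rewrite !coordB !coord_swap; congr absz; ring.
- by rewrite /swap_height !coord_swap tpermL tpermR !eqxx ji (negPf ij); lia.
- apply: coordP => k; rewrite coord_swap; move: x0; rewrite /swap_height.
  by case: tpermP => [->|->|/eqP/negPf-> /eqP/negPf->]; rewrite ?eqxx ?ji ?(negPf ij); lia.
- by rewrite /swap_height; have := neighbor_coord2 ij xy; lia.
- by rewrite /swap_height !coord0; lia.
Qed.

Definition coord_sum x : int := \sum_i coord x i.

Lemma coord_sum_swap i j c x : coord_sum (shifted_swap i j c x) = coord_sum x.
Proof.
rewrite /coord_sum; under eq_bigr do rewrite coord_swap.
rewrite big_split /= -mulr_sumr sumrB.
rewrite [in RHS](reindex_inj (@perm_inj _ (tperm i j))) /=.
have ind l : \sum_k (k == l)%:R = 1 :> int.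
  by rewrite (bigD1 l) //= eqxx big1 ?addr0 // => k /negPf->.
by rewrite !ind subrr mulr0 addr0.
Qed.

(** Up to the factor d^2, the squared Euclidean distance from x to the point with
    coordinates - k / d, which is interior to the alcove defined below. *)
Definition energy x : nat := (\sum_k `|(d%:Z * coord x k + k%:Z) ^+ 2|)%N.

(** A reflection brings a point closer to every point strictly on the other side
    of its hyperplane.  Quantitatively, with t = x_i - x_j - c the energy drops
    by 2 d t (d c + i - j), and the last factor is positive both for i < j,
    c = 1 and for j < i, c = 0. *)
Lemma energy_swap i j x : i != j ->
  swap_height i j (i < j)%N x < 0 ->
  (energy (shifted_swap i j (i < j)%N x) < energy x)%N.
Proof.
move=> ij; rewrite /swap_height /energy => hx.
have ji : j != i by rewrite eq_sym.
rewrite (bigD1 i) // (bigD1 j) //= [leqRHS](bigD1 i) // (bigD1 j ji) /=.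
rewrite (eq_bigr (fun k => `|(d%:Z * coord x k + k%:Z) ^+ 2|%N)); last first.
  move=> k /andP[ki kj]; have tk : tperm i j k = k by rewrite tpermD // eq_sym.
  by rewrite coord_swap tk (negPf ki) (negPf kj) subrr mulr0 addr0.
rewrite !addnA ltn_add2r !coord_swap tpermL tpermR !eqxx (negPf ij) (negPf ji).
have lt_id := ltn_ord i; have lt_jd := ltn_ord j.
move: (coord x i) (coord x j) hx => a b.
have [lt_ij|le_ji] := ltnP i j; rewrite -ltz_nat !PoszD !abszE !ger0_norm ?sqr_ge0 //.
  rewrite !subr0 !sub0r !mul1r -[true%:R]/(1 : int) => hx.
  have {}hx : 0 < a - b - 1 by lia.
  have : 0 < d%:Z * (a - b - 1) * (d%:Z - (j%:Z - i%:Z)).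
    by rewrite !mulr_gt0 //; lia.
  lra.
rewrite !mul0r !addr0 => hx.
have {}hx : 0 < a - b by lia.
have lt_ji : (j < i)%N by rewrite ltn_neqAle ji.
have : 0 < d%:Z * (a - b) * (i%:Z - j%:Z) by rewrite !mulr_gt0 //; lia.
lra.
Qed.

(** A closed fundamental domain of the affine Weyl group of type A_(d-1): the
    coordinates are nonincreasing and differ by at most 1. *)
Definition alcove x : bool :=
  [forall i, forall j, (i != j) ==> (coord x i <= coord x j + (i < j)%N)].

Lemma alcoveP x : reflect
  (forall i j, i != j -> coord x i <= coord x j + (i < j)%N) (alcove x).
Proof.
apply: (iffP forallP) => H i; first by move=> j; apply/implyP; exact: (forallP (H i)).
by apply/forallP => j; apply/implyP; exact: H.
Qed.

(** If x_i > y_i then y_j > x_j for some j by equality of the sums, and the two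
    alcove conditions add up to 2 <= (i < j) + (j < i). *)
Lemma alcove_coord_sum_inj x y :
  alcove x -> alcove y -> coord_sum x = coord_sum y -> x = y.
Proof.
move=> /alcoveP ax /alcoveP ay sxy.
suff le u v : (forall i j, i != j -> coord u i <= coord u j + (i < j)%N) ->
    (forall i j, i != j -> coord v i <= coord v j + (i < j)%N) ->
    coord_sum u = coord_sum v -> forall i, coord u i <= coord v i.
  by apply: coordP => i; apply/eqP; rewrite eq_le !le.
move=> {x y ax ay sxy} au av suv i; rewrite leNgt; apply/negP => vu.
have [j uv] : exists j, coord u j < coord v j.
  apply/existsP; apply: contraT; rewrite negb_exists => /forallP H.
  have : coord_sum v < coord_sum u.
    rewrite /coord_sum (bigD1 i) //= [ltRHS](bigD1 i) //=.
    by apply: ltr_leD => //; apply: ler_sum => k _; have := H k; rewrite -leNgt.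
  by rewrite suv ltxx.
have ij : i != j by apply: contraTneq uv => <-; rewrite -leNgt ltW.
have := au _ _ ij; have := av j i; rewrite eq_sym ij => /(_ isT).
have : ((i < j) + (j < i) <= 1)%N by lia.
lia.
Qed.

(** Induction on the total energy: as long as some point of S is outside the
    alcove, a fold across a wall that separates it from the alcove decreases
    the energy and loses neither covering walks nor coordinate sums.  When all
    points are in the alcove, S contains T. *)
Lemma cover_count_alcove n N S T :
  (forall m, (m <= N)%N -> exists2 x, x \in S & coord_sum x = m) ->
  (forall x, x \in T -> alcove x /\ exists2 m, (m <= N)%N & coord_sum x = Posz m) ->
  (cover_count n S <= cover_count n T)%N.
Proof.
move=> + HT; have [e] := ubnP (\sum_(x <- S) energy x)%N.
elim: e S => // e IH S lt_e HS.
have [/allP allS|] := boolP (all alcove S).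
  apply: cover_countS => x /HT[ax [m /HS[y yS sy] sx]].
  by rewrite (alcove_coord_sum_inj ax (allS y yS)) // sx.
case/allPn => x xS /forallPn[i /forallPn[j]]; rewrite negb_imply => /andP[ij].
rewrite -ltNge => hx; set c := Posz _ in hx.
have refl := reflection_swap (c := c) ij isT.
apply: leq_trans (cover_count_fold refl n S) _; apply: IH.
  move: lt_e; rewrite ltnS; apply: leq_trans; rewrite big_map.
  have le_energy y : (energy (fold (swap_height i j c) (shifted_swap i j c) y) <= energy y)%N.
    by rewrite /fold; case: ltP => // hy; apply/ltnW/energy_swap.
  rewrite (big_rem x xS) [leqRHS](big_rem x xS) /= -addSn leq_add //.
    by rewrite /fold; case: ltP => hy; [exact: energy_swap | rewrite /swap_height in hy; lia].
  by apply: leq_sum => y _.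
move=> m /HS[y yS sy]; exists (fold (swap_height i j c) (shifted_swap i j c) y).
  exact: map_f.
by rewrite /fold; case: ifP; rewrite ?coord_sum_swap.
Qed.

(** Absolute values taken only at the coordinates in r, which describes the state
    after folding across the hyperplanes x_k = 0 for k in r. *)
Definition abs_on (r : seq 'I_d) x : lattice d :=
  \row_k (if k \in r then `|coord x k| else coord x k).

Lemma coord_abs_on r x k :
  coord (abs_on r x) k = if k \in r then `|coord x k| else coord x k.
Proof. by rewrite /coord mxE. Qed.

Lemma cover_count_abs_on n r S :
  (cover_count n S <= cover_count n (map (abs_on r) S))%N.
Proof.
elim: r => [|i r IH].
  rewrite (eq_map (g := id)) ?map_id // => x.
  by apply: coordP => k; rewrite coord_abs_on.
apply: leq_trans IH _; apply: leq_trans (cover_count_fold (reflection_negate i) n _) _.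
rewrite -map_comp (eq_map (g := abs_on (i :: r))) // => x /=.
apply: coordP => k; rewrite /fold [in RHS]coord_abs_on inE.
have [->|ki] /= := eqVneq k i; last first.
  by case: ifP => _; rewrite ?coord_negate ?(negPf ki) coord_abs_on.
by case: ltP => hx; rewrite ?coord_negate ?eqxx; move: hx; rewrite coord_abs_on; case: ifP => _; lia.
Qed.

(** A discrete intermediate value theorem: the norm changes by at most 1 at each
    step. *)
Lemma path_l1norm_levels x (w : seq (lattice d)) n : path (@neighbor d) x w ->
  (l1norm x <= n <= l1norm (last x w))%N ->
  exists2 y, y \in x :: w & l1norm y = n.
Proof.
elim: w x => [|y w IH] x /=.
  by move=> _ xn; exists x; [exact: mem_head | lia].
case/andP=> xy yw /andP[xn nw].
have [xn1|xn1] := eqVneq (l1norm x) n; first by exists x; rewrite ?mem_head.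
have [|z zw zn] := IH y yw; last by exists z; rewrite // inE zw orbT.
rewrite nw andbT; have := l1norm_triangle x y; rewrite (eqP xy); lia.
Qed.

Lemma connects_levels N (p : seq (lattice d)) m : nn_path p -> connects N p ->
  (m <= N)%N -> exists2 x, x \in p & l1norm x = m.
Proof.
case: p => [|x p] pp [K [// [sp] /= x0 pK]] mN; apply: path_l1norm_levels => //.
have lastN : l1norm (last x p) = N.
  have : has (fun x : lattice d => l1norm x == N) (x :: p).
    by rewrite has_find /= pK sp.
  move/(nth_find 0); rewrite /= pK => /eqP; rewrite (last_nth 0) -sp //.
rewrite lastN mN andbT x0 l1normE big1 // => i _; by rewrite coord0.
Qed.

Lemma mem_cyclic_path N x : (0 < d)%N -> x \in cyclic_path d N ->
  exists q m, [/\ (m < d)%N, (d * q + m <= N)%N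
    & forall i, coord x i = q%:Z + (i < m)%N%:Z].
Proof.
move=> d0 xp.
have arc (k m : nat) i : coord ((\sum_(i < d) basis_vec i) *+ k +
    \sum_(i < d | (i < m)%N) basis_vec i) i = k%:Z + (i < m)%N%:Z.
  have coord_sumv (P : pred 'I_d) :
      coord (\sum_(i < d | P i) basis_vec i) i = (P i)%:R.
    rewrite /coord summxE big_mkcond (bigD1 i) //= mxE !eqxx big1 ?addr0; first by case: (P i).
    by move=> j /negPf ji; rewrite mxE eq_sym ji andbF if_same.
  have coordMn l : coord ((\sum_(i < d) basis_vec i) *+ l) i = l.
    elim: l => [|l IH]; first by rewrite mulr0n coord0.
    by rewrite mulrS coordD IH (coord_sumv xpredT); lia.
  by rewrite coordD coord_sumv coordMn; case: (i < m)%N.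
have Nd := divn_eq N d; have md := ltn_pmod N d0.
move: xp; rewrite mem_cat => /orP[/flattenP[_ /mapP[k + ->]]|].
  rewrite mem_iota => /andP[k1 kN]; rewrite /diag_arc /arc1 -map_comp.
  case/mapP=> m; rewrite mem_iota /= add0n => md' ->.
  exists (k - 1)%N, m; split=> [//||i]; last exact: arc.
  have : ((k - 1).+1 * d <= (N %/ d) * d)%N by rewrite leq_mul2r; lia.
  by rewrite mulSn (mulnC d); lia.
rewrite /diag_arc /arc1 -map_comp -map_take take_iota.
case/mapP=> m; rewrite mem_iota /= add0n (mulnC d) => lt_m ->.
exists (N %/ d)%N, m; split=> [||i]; [lia | rewrite (mulnC d); lia |].
by rewrite subSS subn0; exact: arc.
Qed.

Lemma cyclic_path_alcove N x : (0 < d)%N -> x \in cyclic_path d N ->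
  alcove x /\ exists2 m, (m <= N)%N & coord_sum x = Posz m.
Proof.
move=> d0 /(mem_cyclic_path d0) [q [m [md mN xE]]]; split.
  by apply/alcoveP => i j ij; rewrite !xE; lia.
exists (d * q + m)%N => //; rewrite /coord_sum.
under eq_bigr do rewrite xE.
rewrite big_split /= sumr_const card_ord -mulr_natl.
have -> : \sum_(i < d) Posz (i < m)%N = m; last by lia.
rewrite -(big_mkord xpredT (fun l : nat => Posz (l < m)%N)) (big_cat_nat (n := m)) //=; last exact: ltnW.
rewrite [X in X + _](eq_big_nat _ _ (F2 := fun=> 1)); last by move=> l /andP[_ ->].
rewrite [X in _ + X]big_nat [X in _ + X]big1 => [|l /andP[ml _]]; last by rewrite /= ltnNge ml.
by rewrite sumr_const_nat; lia.
Qed.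

Lemma cover_count_cyclic_path n N (p : seq (lattice d)) : (0 < d)%N ->
  nn_path p -> connects N p -> (cover_count n p <= cover_count n (cyclic_path d N))%N.
Proof.
move=> d0 pp pN; apply: leq_trans (cover_count_abs_on n (ord_enum d) p) _.
apply: cover_count_alcove => [m mN|x]; last exact: cyclic_path_alcove.
have [x xp xm] := connects_levels pp pN mN.
exists (abs_on (ord_enum d) x); first exact: map_f.
rewrite /coord_sum -xm l1normE -natz natr_sum; apply: eq_bigr => i _.
by rewrite coord_abs_on mem_ord_enum natz abszE.
Qed.

End Reflections.

(** * From probabilities to counts *)

Section Probability.
Variables (d : nat) (disp : measure_display) (Om : measurableType disp).
Variables (R : realType) (Pr : probability Om R).
Local Open Scope ereal_scope.

Lemma probability_setI1 (A B : set Om) : measurable A -> measurable B ->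
  Pr A = 1 -> Pr (A `&` B) = Pr B.
Proof.
move=> mA mB A1.
suff BA : Pr (B `\` A) = 0.
  have -> : Pr B = Pr (B `\` A) + Pr (B `&` A) by exact: measureDI.
  by rewrite BA add0e setIC.
apply/eqP; rewrite eq_le measure_ge0 andbT.
have <- : Pr (~` A) = 0 by rewrite probability_setC // A1 subee.
rewrite setDE; apply: measureIr; [exact: mB | exact: measurableC].
Qed.

Variable X : nat -> {RV Pr >-> lattice d}.

Lemma measurable_at n (x : lattice d) : measurable [set w | X n w = x].
Proof.
by have := measurable_funPT (X n); move/(_ measurableT [set x] I); rewrite setTI.
Qed.

(** The value of X n ranges over a countable set, so that the event is a countable
    union of events about the two positions. *)
Lemma measurable_increment n (v : lattice d) :
  measurable [set w | increment X n w = v].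
Proof.
have -> : [set w | increment X n w = v] =
    \bigcup_(x : 'rV[int]_d) ([set w | X n w = x] `&` [set w | X n.+1 w = ((x : lattice d) + v)%R]).
  apply/seteqP; split=> [w <-|w [x _ [/= <-]]]; rewrite /increment /=.
    by exists (X n w) => //; split=> //=; rewrite addrC subrK.
  by move=> ->; rewrite addrC addKr.
apply: countable_bigcupT_measurable => [|x]; first exact: countableP.
by apply: measurableI; exact: measurable_at.
Qed.

Definition trajectory (L : nat) (w : Om) : seq (lattice d) :=
  mkseq (fun n => X n w) L.+1.

Lemma measurable_trajectory L (q : seq (lattice d)) :
  measurable [set w | trajectory L w = q].
Proof.
rewrite /trajectory /mkseq; elim: (iota 0 L.+1) q => [|n s IH] [|x q] /=.
- by rewrite (_ : [set w | _] = setT) //; apply/seteqP; split.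
- by rewrite (_ : [set w | _] = set0) //; apply/seteqP; split.
- by rewrite (_ : [set w | _] = set0) //; apply/seteqP; split.
rewrite (_ : [set w | _] = [set w | X n w = x] `&` [set w | [seq X m w | m <- s] = q]).
  by apply: measurableI => //; exact: measurable_at.
by apply/seteqP; split=> w /= [-> ->].
Qed.

Lemma measurable_visits L (x : lattice d) :
  measurable [set w | x \in trajectory L w].
Proof.
rewrite /trajectory /mkseq; elim: (iota 0 L.+1) => [|n s IH] /=.
  by rewrite (_ : [set w | _] = set0) //; apply/seteqP; split.
rewrite (_ : [set w | _] = [set w | X n w = x] `|` [set w | x \in [seq X m w | m <- s]]).
  by apply: measurableU => //; exact: measurable_at.
apply/seteqP; split=> w /=; rewrite inE.
  by case/orP => [/eqP->|]; [left | right].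
by case=> [->|->]; rewrite ?eqxx ?orbT.
Qed.

Lemma measurable_covers L (S : seq (lattice d)) :
  measurable [set w | covers S (trajectory L w)].
Proof.
elim: S => [|x S IH] /=.
  by rewrite (_ : [set w | _] = setT) //; apply/seteqP; split.
rewrite (_ : [set w | _] =
  [set w | x \in trajectory L w] `&` [set w | covers S (trajectory L w)]).
  by apply: measurableI => //; exact: measurable_visits.
by apply/seteqP; split=> w /= => [/andP|] [-> ->].
Qed.

Hypothesis X_srw : simple_random_walk X.

Let step_prob : R := ((2 * d)%:R)^-1%R.

Lemma probability_trajectory L (q : seq (lattice d)) : q \in walks_from L (0%R : lattice d) ->
  Pr [set w | trajectory L w = q] = (step_prob ^+ L)%R%:E.
Proof.
case/mem_walks_from => t -> /andP[/eqP tL pt].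
pose v i := (nth 0 (0%R :: t) i.+1 - nth 0 (0%R :: t) i)%R.
pose B := \bigcap_(i in [set` iota 0 L]) (increment X i @^-1` [set v i]).
have mB : measurable B.
  apply: bigcap_measurableType => i _; exact: measurable_increment.
have -> : [set w | trajectory L w = 0%R :: t] = [set w | X 0%N w = 0%R] `&` B.
  apply/seteqP; split=> [w /= Xt|w [/= X0 Bw]].
    have Xi i : (i <= L)%N -> X i w = nth 0%R (0%R :: t) i.
      by move=> iL; rewrite -Xt nth_mkseq.
    split=> [|i /=]; first by rewrite Xi.
    by rewrite mem_iota /= add0n => iL; rewrite /increment /= !Xi // ltnW.
  apply: (@eq_from_nth _ 0%R); first by rewrite size_mkseq /= tL.
  move=> i; rewrite size_mkseq => iL; rewrite nth_mkseq //.
  elim: i iL => [|i IH] iL; first by rewrite X0.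
  have := Bw i; rewrite /= mem_iota add0n => /(_ iL).
  by rewrite /increment /v IH ?(ltnW iL) // => /addIr.
rewrite (probability_setI1 (measurable_at 0 0%R) mB (srw_start X_srw)).
rewrite /B (srw_indep X_srw) ?iota_uniq //.
rewrite (eq_big_seq (fun=> step_prob%:E)) => [|i].
  rewrite -[in RHS](size_iota 0 L); elim: (iota 0 L) => [|j s IH].
    by rewrite big_nil expr0.
  by rewrite big_cons IH -EFinM exprS.
rewrite mem_iota add0n => /= iL; apply: (srw_uniform X_srw).
have /(pathP 0%R) /(_ i) := pt; rewrite tL => /(_ iL) /eqP.
by [].
Qed.

Lemma probability_trajectories L (W : seq (seq (lattice d))) :
  uniq W -> {subset W <= walks_from L (0%R : lattice d)} ->
  measurable [set w | trajectory L w \in W] /\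
  Pr [set w | trajectory L w \in W] = ((size W)%:R * step_prob ^+ L)%R%:E.
Proof.
elim: W => [_ _|q W IH /= /andP[qW /IH{}IH] sub].
  rewrite (_ : [set w | _] = set0); last by apply/seteqP; split.
  by rewrite measure0 mul0r.
have [|mW PW] := IH; first by move=> q' q'W; apply: sub; rewrite inE q'W orbT.
have -> : [set w | trajectory L w \in q :: W] =
    [set w | trajectory L w = q] `|` [set w | trajectory L w \in W].
  apply/seteqP; split=> w /=; rewrite inE.
    by case/orP => [/eqP->|]; [left | right].
  by case=> [->|->]; rewrite ?eqxx ?orbT.
split; first by apply: measurableU => //; exact: measurable_trajectory.
set A := [set w | trajectory L w = q]; set B := [set w | trajectory L w \in W].
have -> : Pr (A `|` B) = Pr A + Pr B.
  apply: measureU => //; first exact: measurable_trajectory.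
  apply/seteqP; split=> w // [Aw Bw]; case/negP: qW.
  by rewrite -(Aw : trajectory L w = q).
rewrite PW probability_trajectory ?sub ?mem_head // -EFinD.
by rewrite -[in RHS]add1n natrD mulrDl mul1r.
Qed.

(** The walks in [walks_from L 0] carry total mass (2d)^L (2d)^(-L) = 1, hence
    almost surely the trajectory is one of them. *)
Lemma probability_covers L (S : seq (lattice d)) : (0 < d)%N ->
  Pr [set w | Trace S `<=` Trace (mkseq (fun n => X n w) L.+1)] =
  ((cover_count L S)%:R * step_prob ^+ L)%R%:E.
Proof.
move=> d0; pose W := walks_from L (0%R : lattice d).
have [mW PW] := probability_trajectories (walks_from_uniq L 0%R) (fun _ => id).
have {}PW : Pr [set w | trajectory L w \in W] = 1.
  rewrite PW size_walks_from natrX -exprMn mulfV ?expr1n //.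
  by rewrite pnatr_eq0; lia.
have -> : [set w | Trace S `<=` Trace (mkseq (fun n => X n w) L.+1)] =
    [set w | covers S (trajectory L w)].
  by apply/seteqP; split=> w /= => [H|/allP H]; first apply/allP.
rewrite -(probability_setI1 mW (measurable_covers L S) PW).
have -> : [set w | trajectory L w \in W] `&` [set w | covers S (trajectory L w)] =
    [set w | trajectory L w \in [seq q <- W | covers S q]].
  apply/seteqP; split=> w /=; rewrite mem_filter; first by case=> -> ->.
  by case/andP.
have [||_ ->] := @probability_trajectories L [seq q <- W | covers S q].
- exact/filter_uniq/walks_from_uniq.
- exact: mem_subseq (filter_subseq _ _).
by rewrite size_filter.
Qed.

End Probability.

Theorem theorem1p4 (d L N : nat) (d_gt0 : (0 < d)%N) (N_gt0 : (1 <= N)%N)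
    (leNL : (N <= L)%N)
    (p : seq (lattice d)) (p_path : nn_path p) (p_connects : connects N p)
    (disp : measure_display) (Om : measurableType disp) (R : realType)
    (Pr : probability Om R) (X : nat -> {RV Pr >-> lattice d})
    (X_srw : simple_random_walk X) :
  (Pr [set w | Trace p `<=` Trace (mkseq (fun n => X n w) L.+1)] <=
   Pr [set w | Trace (cyclic_path d N) `<=`
               Trace (mkseq (fun n => X n w) L.+1)])%E.
Proof.
rewrite !(probability_covers X_srw) // lee_fin ler_wpM2r ?exprn_ge0 ?invr_ge0 //.
by rewrite ler_nat; exact: cover_count_cyclic_path.
Qed.
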